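(* There is an absolute constant $\gamma>0$ such that, for every positive integer $n$, the $n$-dimensional Bohr radius $K_n$ satisfies \[ K_n\ge \gamma \sqrt{\frac{\log n}{n}} . \]
   Context: $\mathbb{D}^n=\{z\in\mathbb{C}^n: |z_k|<1,\ k=1,\dots,n\}$ is the open unit polydisc and $r\mathbb{D}^n=\{rz: z\in\mathbb{D}^n\}$. For multi-indices $\alpha=(\alpha_1,\dots,\alpha_n)$ of non-negative integers, $z^\alpha=z_1^{\alpha_1}\cdots z_n^{\alpha_n}$. The $n$-dimensional Bohr radius $K_n$ is the largest positive number $r$ such that all polynomials $\sum_\alpha a_\alpha z^\alpha$ in $n$ complex variables (with complex coefficients, of arbitrary degree, not necessarily homogeneous) satisfy \[ \sup_{z\in r\mathbb{D}^n}\sum_\alpha |a_\alpha z^\alpha| \le \sup_{z\in\mathbb{D}^n}\Bigl|\sum_\alpha a_\alpha z^\alpha\Bigr| . \] *)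

(* Defs.v *)
From HB Require Import structures.
From mathcomp Require Import all_boot all_order all_algebra.
From mathcomp Require Import complex.
From mathcomp Require Import all_classical all_reals all_analysis.
(* Not imported: the notations of mpoly clash with those of all_analysis. *)
From mathcomp Require mpoly.

Set Implicit Arguments.
Unset Strict Implicit.
Unset Printing Implicit Defensive.

Import Order.TTheory GRing.Theory Num.Theory.

Local Open Scope classical_set_scope.
Local Open Scope ring_scope.
Local Open Scope complex_scope.

(* The norm of R[i] takes its values in R[i]; this is the R-valued modulus. *)
Notation modulus := ComplexField.Normc.normc.

Definition polydisc (R : realType) (n : nat) : set ('I_n -> R[i]) :=
  [set z | forall k, modulus (z k) < 1].
Arguments polydisc R n : clear implicits.

Definition scaled_polydisc (R : realType) (n : nat) (r : R) :
    set ('I_n -> R[i]) :=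
  [set (fun k => r%:C * z k) | z in polydisc R n].
Arguments scaled_polydisc {R} n r.

(* mmap1 z a is the monomial z^a = \prod_(k < n) z k ^+ a k; the multi-indices
   outside the support of p contribute 0 to the sum over all a. *)
Definition abs_sum (R : realType) (n : nat) (p : mpoly.mpoly n R[i])
    (z : 'I_n -> R[i]) : R :=
  \sum_(a <- mpoly.msupp p)
    modulus (mpoly.mcoeff a p * mpoly.mmap1 z a).

(* The suprema are taken in the extended reals, so that no boundedness or
   nonemptiness side condition is needed for them to be meaningful. *)
Definition bohr_inequality (R : realType) (n : nat) (r : R) : Prop :=
  forall p : mpoly.mpoly n R[i],
    (ereal_sup [set (abs_sum p z)%:E | z in scaled_polydisc n r] <=
     ereal_sup [set (modulus (mpoly.meval z p))%:E | z in polydisc R n])%E.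

Definition is_bohr_radius (R : realType) (n : nat) (K : R) : Prop :=
  [/\ 0 < K,
      bohr_inequality n K &
      forall r : R, 0 < r -> bohr_inequality n r -> r <= K].

(* Main.v *)
(** The argument replaces the hypercontractive Bohnenblust-Hille inequality by
    its first step. Let [M] bound [p = \sum_a c_a z^a] on the polydisc and let
    [P_m] be the m-homogeneous part of [p]. Positivity of [M - 'Re p] gives
    [|P_m| <= 2 (M - |c_0|)] for [m >= 1]. Replacing [w_i] by
    [w_i (1 + eps_i s) / 3] and extracting the coefficient of [s] gives
    [\sum_i |w_i d_i P_m(w)| <= 3^m * 2 (M - |c_0|)] on the torus. An
    m-homogeneous [q] satisfies [|q|_4^2 = |q^2|_2 <= 2^m |q|_2^2], because a
    multi-index of degree [2 m] splits in at most [4^m] ways, hence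
    [|q|_2 <= 2^m |q|_1]. Averaging over the torus and using Cauchy-Schwarz for
    each [i] yields [\sum_(|a| = m) |c_a| <= 2 * 6^m sqrt(N_m) (M - |c_0|)],
    where [N_m] bounds the number of multi-indices of degree [m - 1] only.
    Generating functions give [N_m = x^-(m - 1) (1 - x)^-n] for any
    [0 < x < 1], so that [x <= (1 - x)^n] and [r = sqrt x / 24] turn the sum
    over [m] into a geometric series; [x = (1 + ln n) / (4 n)] is admissible. *)

Require Import Defs.
From mathcomp Require Import all_boot all_order all_algebra.
From mathcomp Require Import all_solvable all_field.
From mathcomp Require Import complex zify ring lra.
From mathcomp Require Import all_classical all_reals all_analysis.
From mathcomp Require mpoly.
Import -(notations) mpoly.

Set Implicit Arguments.
Unset Strict Implicit.
Unset Printing Implicit Defensive.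

Import Order.TTheory GRing.Theory Num.Theory.

Local Open Scope ring_scope.

(** * Discrete Fourier analysis on roots of unity *)

Section RootsOfUnity.
Variable C : numClosedFieldType.

Lemma closed_prim_root_exists N : (0 < N)%N ->
  exists zeta : C, N.-primitive_root zeta.
Proof.
move=> N_gt0.
have [r Dr] := closed_field_poly_normal ('X^N - 1 : {poly C}).
rewrite (monicP _) ?monicXnsubC // scale1r in Dr.
have /hasP[z _ prim_z] : has N.-primitive_root r.
  apply: has_prim_root => //.
  - by apply/allP=> z; rewrite -root_prod_XsubC -Dr.
  - rewrite -separable_prod_XsubC -Dr separable_Xn_sub_1 //.
    by rewrite pnatr_eq0 -lt0n.
  - by rewrite -ltnS -(size_prod_XsubC r id) -Dr size_XnsubC.
by exists z.
Qed.

Variables (N : nat) (zeta : C).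
Hypothesis zeta_prim : N.-primitive_root zeta.

Let N_gt0 : (0 < N)%N := prim_order_gt0 zeta_prim.

Lemma norm_prim_root : `|zeta| = 1.
Proof.
apply/eqP; rewrite -(@pexpr_eq1 _ _ N) ?normr_ge0 // -normrX.
by rewrite (prim_expr_order zeta_prim) normr1.
Qed.

Lemma norm_prim_rootX k : `|zeta ^+ k| = 1.
Proof. by rewrite normrX norm_prim_root expr1n. Qed.

Lemma sum_prim_root e e' : (e < N)%N -> (e' < N)%N ->
  \sum_(k < N) (zeta ^+ k) ^+ e * ((zeta ^+ k) ^+ e')^* =
  N%:R * (e == e')%:R.
Proof.
move=> ltN ltN'; have z_unit : zeta != 0 by rewrite -normr_gt0 norm_prim_root.
pose eta := zeta ^+ e / zeta ^+ e'.
have -> : \sum_(k < N) (zeta ^+ k) ^+ e * ((zeta ^+ k) ^+ e')^* =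
          \sum_(k < N) eta ^+ k.
  apply: eq_bigr => k _; rewrite -!exprM rmorphXn /=.
  have -> : zeta^* = zeta^-1.
    by rewrite invC_norm norm_prim_root expr1n invr1 mul1r.
  by rewrite /eta expr_div_n -!exprM exprVn mulnC (mulnC k).
have eta1 : eta ^+ N = 1.
  rewrite /eta expr_div_n -!(exprAC _ N) (prim_expr_order zeta_prim).
  by rewrite !expr1n divr1.
have [eqe|neq] := eqVneq e e'.
  rewrite mulr1 (eq_bigr (fun=> 1)) => [|k _].
    by rewrite sumr_const card_ord.
  by rewrite /eta eqe divff ?expr1n // expf_neq0.
rewrite mulr0; apply/eqP; have := subrX1 eta N.
rewrite eta1 subrr => /esym/eqP; rewrite mulf_eq0 subr_eq0 => /orP[|//].
rewrite /eta -(inj_eq (mulIf (expf_neq0 e' z_unit))) divfK ?expf_neq0 //.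
by rewrite mul1r (eq_prim_root_expr zeta_prim) !modn_small // (negbTE neq).
Qed.

(** Discrete Fourier inversion, by exchanging the sums; it is exact because distinct exponents below
    [N] stay distinct modulo [N]. *)
Lemma coef_prim_root (f : {poly C}) l : (size f <= N)%N -> (l < N)%N ->
  N%:R * f`_l = \sum_(k < N) f.[zeta ^+ k] * ((zeta ^+ k) ^+ l)^*.
Proof.
move=> szf ltlN.
under eq_bigr => k _ do rewrite (horner_coef_wide _ szf) mulr_suml.
rewrite exchange_big /= (bigD1 (Ordinal ltlN)) //=.
rewrite [X in _ + X]big1 ?addr0 => [|i /negbTE neq].
  under eq_bigr do rewrite -mulrA.
  by rewrite -mulr_sumr sum_prim_root // eqxx mulr1 mulrC.
under eq_bigr do rewrite -mulrA.
rewrite -mulr_sumr sum_prim_root //.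
by rewrite (_ : (i : nat) == l = false) ?mulr0 // -neq -val_eqE.
Qed.

End RootsOfUnity.

(** * Coefficient estimates for polynomials in one variable *)

Section Polynomials.
Variable C : numClosedFieldType.
Implicit Types (f : {poly C}) (M : C).

(** Cauchy's estimate, with a mean over roots of unity of order above the degree in place of the
    contour integral. *)
Lemma coef_le_sup f M l : (forall t, `|t| = 1 -> `|f.[t]| <= M) -> `|f`_l| <= M.
Proof.
move=> fM; pose N := (size f + l).+1.
have [z zP] := closed_prim_root_exists C (ltn0Sn (size f + l)).
have := coef_prim_root zP (leqW (leq_addr l (size f))) (leq_addl _ _).
move/(congr1 Num.norm); rewrite normrM normr_nat => E.
rewrite -(ler_pM2l (ltr0Sn C (size f + l))) E.
apply: (le_trans (ler_norm_sum _ _ _)).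
rewrite -[X in X%:R * _]card_ord mulr_natl -sumr_const.
apply: ler_sum => k _.
rewrite normrM norm_conjC normrX (norm_prim_rootX zP) expr1n mulr1 fM //.
exact: norm_prim_rootX zP k.
Qed.

Lemma exists_phase (c : C) : exists2 u : C, `|u| = 1 & u * c = `|c|.
Proof.
have [->|c0] := eqVneq c 0; first by exists 1; rewrite ?normr1 // normr0 mulr0.
exists (`|c| / c); last by rewrite divfK.
by rewrite normrM normfV normr_id divff // normr_eq0.
Qed.

(* Rotate so that the constant coefficient is [`|f`_0|]; the function
   [M - 'Re f] is then nonnegative with mean [M - `|f`_0|], and its Fourier
   coefficient of index [- l] is half that of [f], up to sign. *)
Lemma coef_le_sup_sub0 f M l : (forall t, `|t| = 1 -> `|f.[t]| <= M) ->
  (0 < l)%N -> `|f`_l| <= 2 * (M - `|f`_0|).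
Proof.
move=> fM l_gt0; have [u u1 uf0] := exists_phase f`_0.
pose g := u *: f; pose N := (size f + l).+1.
have [z zP] := closed_prim_root_exists C (ltn0Sn (size f + l)).
have szg : (size g <= N)%N.
  by rewrite (leq_trans (size_scale_leq _ _)) // leqW // leq_addr.
have ltl : (l < N)%N by rewrite ltnS leq_addl.
pose w k : C := z ^+ k; have w1 k : `|w k| = 1 := norm_prim_rootX zP k.
have gl := coef_prim_root zP szg ltl.
have g0 := coef_prim_root zP szg (ltn0Sn _).
have cl : \sum_(k < N) ((w k) ^+ l)^* = 0.
  have := sum_prim_root zP (ltn0Sn _) ltl.
  rewrite (ltn_eqF l_gt0) mulr0 => s0; rewrite -[RHS]s0.
  by apply: eq_bigr => k _; rewrite expr0 mul1r.
(* The conjugate of [g] carries only nonpositive frequencies, hence not the frequency [l > 0]. The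
   order [N] exceeds the degree of [g * 'X^l], which rules out aliasing. *)
have gX : \sum_(k < N) (g.[w k])^* * ((w k) ^+ l)^* = 0.
  have sz : (size (g * 'X^l)%R <= N)%N.
    have [->|gn0] := eqVneq g 0; first by rewrite mul0r size_poly0.
    by rewrite size_mulXn // addnC ltnW // ltnS leq_add2r size_scale_leq.
  have := coef_prim_root zP sz (ltn0Sn _).
  rewrite coefMXn l_gt0 mulr0 => /(congr1 Num.conj); rewrite rmorph0 rmorph_sum.
  move=> s0; rewrite [RHS]s0 /=; apply: eq_bigr => k _.
  by rewrite expr0 conjC1 mulr1 hornerM hornerXn rmorphM.
have gM k : 'Re (g.[w k]) <= M.
  apply: le_trans (leif_Re_Creal _).1 _.
  by rewrite hornerZ normrM u1 mul1r fM.
have N0 : (0 : C) < N%:R by rewrite ltr0n.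
have sumRe : \sum_(k < N) (M - 'Re (g.[w k])) = N%:R * (M - `|f`_0|).
  rewrite sumrB sumr_const card_ord mulrBr mulr_natl; congr (_ - _).
  transitivity ('Re (\sum_(k < N) g.[w k])).
    by rewrite raddf_sum.
  move: g0; under [in RHS]eq_bigr do rewrite expr0 conjC1 mulr1.
  move=> <-; rewrite coefZ uf0.
  by apply/Creal_ReP/ger0_real; rewrite mulr_ge0 ?ler0n.
have glE : N%:R * g`_l =
    - 2 * \sum_(k < N) (M - 'Re (g.[w k])) * ((w k) ^+ l)^*.
  under [in RHS]eq_bigr do rewrite mulrBl ReE.
  rewrite sumrB -mulr_sumr cl mulr0 sub0r mulrNN.
  rewrite mulr_sumr -[LHS]addr0 -[X in _ + X]gX gl -big_split /=.
  by apply: eq_bigr => k _; field.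
rewrite -(ler_pM2l N0) mulrCA -sumRe.
have -> : N%:R * `|f`_l| = `|N%:R * g`_l|.
  by rewrite normrM normr_nat coefZ normrM u1 mul1r.
rewrite glE normrM normrN normr_nat ler_pM2l ?ltr0n //.
apply: le_trans (ler_norm_sum _ _ _) _; apply: ler_sum => k _.
by rewrite normrM norm_conjC normrX w1 expr1n mulr1 ger0_norm ?subr_ge0.
Qed.
End Polynomials.

(** * Orthogonality and Parseval's identity on the discrete torus *)

Section Torus.
Variables (C : numClosedFieldType) (n N : nat) (zeta : C).
Hypothesis zeta_prim : N.-primitive_root zeta.

Definition torus_pt (k : {ffun 'I_n -> 'I_N}) (i : 'I_n) : C := zeta ^+ k i.

Lemma norm_torus_pt k i : `|torus_pt k i| = 1.
Proof. exact: norm_prim_rootX zeta_prim _. Qed.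

Lemma torus_orthogonality (m m' : multinom n) :
    (forall i, m i < N)%N -> (forall i, m' i < N)%N ->
  \sum_k mmap1 (torus_pt k) m * (mmap1 (torus_pt k) m')^* =
  (N ^ n)%:R * (m == m')%:R.
Proof.
move=> ltm ltm'; rewrite /mmap1.
under eq_bigr => k _ do rewrite rmorph_prod -big_split /=.
rewrite -(bigA_distr_bigA (fun (i : 'I_n) (k : 'I_N) =>
  (zeta ^+ k) ^+ m i * ((zeta ^+ k) ^+ m' i)^*)).
under eq_bigr => i _ do rewrite (sum_prim_root zeta_prim (ltm i) (ltm' i)).
rewrite big_split /= prodr_const card_ord natrX; congr (_ * _).
have [<-|neq] := eqVneq m m'; first by rewrite big1 // => i _; rewrite eqxx.
have /existsP[i neqi] : [exists i, m i != m' i].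
  rewrite -negb_forall; apply: contraNN neq => /forallP eqm.
  by apply/eqP/mnmP => i; apply/eqP.
by rewrite (bigD1 i) //= (negbTE neqi) mul0r.
Qed.

(** Parseval's identity. The exponents [e u] may repeat, hence the double sum: this form also serves
    the square of a polynomial, indexed by pairs of multi-indices. *)
Lemma torus_sqr_norm (U : finType) (P : pred U) (c : U -> C)
    (e : U -> multinom n) :
    (forall u i, e u i < N)%N ->
  \sum_k `|\sum_(u | P u) c u * mmap1 (torus_pt k) (e u)| ^+ 2 =
  (N ^ n)%:R * \sum_(u | P u) \sum_(v | P v && (e v == e u)) c u * (c v)^*.
Proof.
move=> lte.
transitivity (\sum_(u | P u) \sum_(v | P v) \sum_k
    (c u * (c v)^*) *
    (mmap1 (torus_pt k) (e u) * (mmap1 (torus_pt k) (e v))^*)).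
  rewrite [RHS](eq_bigr _ (fun u _ => exchange_big _ _ _ _ _ _)) exchange_big.
  apply: eq_bigr => k _; rewrite normCK rmorph_sum mulr_suml.
  apply: eq_bigr => u _; rewrite mulr_sumr; apply: eq_bigr => v _.
  by rewrite rmorphM mulrACA.
rewrite mulr_sumr; apply: eq_bigr => u _.
rewrite mulr_sumr [RHS]big_mkcondr /=; apply: eq_bigr => v _.
rewrite -mulr_sumr torus_orthogonality // eq_sym.
by case: eqP; rewrite ?(mulr1, mulr0) // mulrC.
Qed.

End Torus.

(** * Elementary inequalities between moments *)

Section L1L2.
Variable C : numClosedFieldType.

(* Sums [3 l^2 t^2 <= 2 l^3 t + t^4] over the values [t] of [f], with
   [l = L * s]. *)
Lemma sqr_norm_le_norm1 (X : finType) (f : X -> C) (T s L : C) :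
    0 < L -> 0 <= s -> (forall x, 0 <= f x) ->
    \sum_x f x ^+ 2 = T * s ^+ 2 ->
    \sum_x f x ^+ 4 <= T * (L * s ^+ 2) ^+ 2 ->
  T * s <= L * \sum_x f x.
Proof.
move=> L_gt0 s_ge0 f_ge0 f2 f4; have [->|s_neq0] := eqVneq s 0.
  by rewrite mulr0 mulr_ge0 ?sumr_ge0 // ltW.
have s_gt0 : 0 < s by rewrite lt_def s_neq0.
pose l := L * s; have l_gt0 : 0 < l by rewrite mulr_gt0.
have ptwise x : 3 * l ^+ 2 * f x ^+ 2 <= 2 * l ^+ 3 * f x + f x ^+ 4.
  rewrite -subr_ge0.
  have -> : 2 * l ^+ 3 * f x + f x ^+ 4 - 3 * l ^+ 2 * f x ^+ 2 =
            f x * ((f x - l) ^+ 2 * (f x + 2 * l)) by ring.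
  rewrite mulr_ge0 // mulr_ge0 //; last first.
    by rewrite addr_ge0 // mulr_ge0 ?ler0n // ltW.
  by rewrite real_exprn_even_ge0 // rpredB ?ger0_real // ltW.
have le1 : 3 * l ^+ 2 * (T * s ^+ 2) <=
           2 * l ^+ 3 * \sum_x f x + \sum_x f x ^+ 4.
  by rewrite -f2 !mulr_sumr -big_split; apply: ler_sum.
have := le_trans le1 (lerD (lexx _) f4); rewrite -lerBlDr.
have -> : 3 * l ^+ 2 * (T * s ^+ 2) - T * (L * s ^+ 2) ^+ 2 =
          (2 * L ^+ 2 * s ^+ 3) * (T * s) by rewrite /l; ring.
have -> : 2 * l ^+ 3 * \sum_x f x = (2 * L ^+ 2 * s ^+ 3) * (L * \sum_x f x).
  by rewrite /l; ring.
by rewrite ler_pM2l // !mulr_gt0 ?exprn_gt0 ?ltr0n.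
Qed.

Lemma sqr_sum_le (I : finType) (P : pred I) (f : I -> C) :
    (forall i, 0 <= f i) ->
  (\sum_(i | P i) f i) ^+ 2 <= #|P|%:R * \sum_(i | P i) f i ^+ 2.
Proof.
move=> f_ge0; rewrite expr2 mulr_suml.
apply: (@le_trans _ _
  (\sum_(i | P i) \sum_(j | P j) (f i ^+ 2 + f j ^+ 2) / 2)).
  apply: ler_sum => i _; rewrite mulr_sumr; apply: ler_sum => j _.
  rewrite -subr_ge0.
  have -> : (f i ^+ 2 + f j ^+ 2) / 2 - f i * f j = (f i - f j) ^+ 2 / 2.
    by field.
  by rewrite divr_ge0 ?ler0n // real_exprn_even_ge0 // rpredB ?ger0_real.
under eq_bigr => i _ do rewrite -mulr_suml big_split /= sumr_const.
rewrite -mulr_suml big_split /= sumr_const sumrMnl mulr_natl.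
by rewrite -mulr2n -[X in X / _]mulr_natr mulfK ?pnatr_eq0.
Qed.

End L1L2.

(** * Counting multi-indices *)

Section Counting.
Variables (C : numClosedFieldType) (n d : nat).

(** Multi-indices of degree at most [d] embed in the box of exponents from 0 to [d], over which the
    sum factors; the extra terms are nonnegative. *)
Lemma sum_bmultinom_le_prod (F : 'I_n -> nat -> C)
    (P : pred (bmultinom n d.+1)) : (forall i j, 0 <= F i j) ->
  \sum_(m : bmultinom n d.+1 | P m) \prod_i F i (bmnm m i) <=
  \prod_i \sum_(j < d.+1) F i j.
Proof.
move=> F_ge0; rewrite bigA_distr_bigA /=.
pose phi (m : bmultinom n d.+1) : {ffun 'I_n -> 'I_d.+1} :=
  [ffun i => inord (bmnm m i)].
have phiE m i : phi m i = bmnm m i :> nat.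
  rewrite ffunE inordK // (leq_ltn_trans _ (bmdeg m)) // mdegE.
  by rewrite (bigD1 i) //= leq_addr.
have phi_inj : injective phi.
  move=> m m' eq_phi; apply/val_inj/mnmP => i /=.
  by rewrite -!phiE eq_phi.
under eq_bigr => m _ do under eq_bigr => i _ do rewrite -phiE.
rewrite -(big_imset (fun f : {ffun 'I_n -> 'I_d.+1} => \prod_i F i (f i))) /=;
  last by move=> ? ? _ _ /phi_inj.
rewrite [leRHS](bigID (mem (phi @: P))) /= lerDl sumr_ge0 // => f _.
exact: prodr_ge0.
Qed.

(** A splitting of [g] is determined by its first part, which is at most [g] in each coordinate;
    this leaves at most [\prod_i (g i + 1) <= \prod_i 2 ^ g i] choices. *)
Lemma card_splittings (g : multinom n)
    (P : pred (bmultinom n d.+1 * bmultinom n d.+1)) :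
    (forall u, P u -> mnm_add (bmnm u.1) (bmnm u.2) = g) ->
  (#|P|%:R : C) <= 2 ^+ mdeg g.
Proof.
move=> Pg.
pose Q := [pred m : bmultinom n d.+1 | [forall i, bmnm m i <= g i]%N].
have PQ : (#|P| <= #|Q|)%N.
  rewrite -(card_in_imset (f := fst)) => [|u v Pu Pv eq1].
    apply/subset_leq_card/fintype.subsetP => _ /imsetP[u Pu ->].
    by apply/forallP => i; rewrite -(Pg u Pu) mnmDE leq_addr.
  rewrite (surjective_pairing u) (surjective_pairing v) eq1; congr (_, _).
  apply/val_inj/mnmP => i; apply/eqP; have := Pg v Pv; rewrite -(Pg u Pu) eq1.
  by move/mnmP/(_ i)/eqP; rewrite !mnmDE eqn_add2l eq_sym.
apply: le_trans (_ : #|Q|%:R <= _); first by rewrite ler_nat.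
have -> : #|Q|%:R = \sum_(m | Q m) \prod_i (bmnm m i <= g i)%N%:R :> C.
  rewrite (eq_bigr (fun=> 1)) ?sumr_const // => m /forallP Qm.
  by rewrite big1 // => i _; rewrite Qm.
apply: le_trans (sum_bmultinom_le_prod (F := fun i j => (j <= g i)%N%:R) _ _) _.
  by move=> * /=; rewrite ler0n.
rewrite mdegE -prodrXr; apply: ler_prod => i _; rewrite sumr_ge0 //=.
rewrite -natr_sum -natrX ler_nat.
have -> : (\sum_(j < d.+1) (j <= g i) = minn d.+1 (g i).+1)%N.
  elim: d.+1 => [|e IHe]; first by rewrite big_ord0 min0n.
  by rewrite big_ord_recr /= IHe; lia.
by rewrite (leq_trans (geq_minr _ _)) // ltn_expl.
Qed.

Lemma sum_geometric_le (x : C) (e : nat) : 0 < x < 1 ->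
  \sum_(j < e) x ^+ j <= (1 - x)^-1.
Proof.
move=> /andP[x_gt0 x_lt1]; have x1 : 0 < 1 - x by rewrite subr_gt0.
rewrite -(ler_pM2l x1) divff ?gt_eqF //.
by rewrite -opprB mulNr -subrX1 opprB gerBl exprn_ge0 // ltW.
Qed.

(** Rankin's trick: multi-indices are weighted by powers of [x], and the weighted sum factors into
    geometric series. Since the variable [i] occurs, one copy of it is removed before weighting,
    which gives [x ^- k] rather than [x ^- k.+1]. *)
Lemma card_mdeg_le (x : C) (k : nat) (i : 'I_n) : 0 < x < 1 ->
  #|[pred m : bmultinom n d.+1 |
      (mdeg (bmnm m) == k.+1) && (0 < bmnm m i)%N]|%:R <=
    x ^- k * (1 - x) ^- n.
Proof.
move=> x01; have /andP[x_gt0 x_lt1] := x01; set Q := [pred m | _].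
pose F (l : 'I_n) (j : nat) : C := ((i == l) <= j)%N%:R * x ^+ (j - (i == l)).
rewrite ler_pdivlMl ?exprn_gt0 //.
have -> : x ^+ k * #|Q|%:R = \sum_(m | Q m) \prod_l F l (bmnm m l).
  rewrite mulr_natr -sumr_const; apply: eq_bigr => m /andP[/eqP degm m_gt0].
  have leQ l : ((i == l) <= bmnm m l)%N by case: eqP => [<-|].
  under eq_bigr => l _ do rewrite /F leQ mul1r.
  rewrite prodrXr; congr (_ ^+ _).
  rewrite sumnB // -mdegE degm (bigD1 i) //= eqxx big1 ?subn1 // => l.
  by rewrite eq_sym => /negbTE ->.
apply: le_trans (sum_bmultinom_le_prod _ _) _.
  by move=> * /=; rewrite mulr_ge0 ?ler0n ?exprn_ge0 ?ltW.
rewrite -exprVn -[X in _ ^+ X]card_ord -prodr_const; apply: ler_prod => l _.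
rewrite sumr_ge0 => [|j _]; last by rewrite mulr_ge0 ?ler0n ?exprn_ge0 ?ltW.
rewrite /F /=; case: (i == l) => /=; last first.
  under eq_bigr do rewrite mul1r subn0.
  exact: sum_geometric_le.
rewrite big_ord_recl ltnn mul0r add0r.
under eq_bigr do rewrite mul1r /= subn1.
exact: sum_geometric_le.
Qed.
End Counting.

(** * The L2 norm of a homogeneous polynomial against its L1 norm *)

Section Hypercontractivity.
Variable C : numClosedFieldType.

(** Apply [2 x_u x_v <= x_u^2 + x_v^2]; by symmetry of [r] both squares contribute the same total,
    in which each [x_u^2] is counted at most [K] times. *)
Lemma schur_test (U : finType) (P : pred U) (r : rel U) (x : U -> C) (K : C) :
    (forall u v, r u v = r v u) -> (forall u, 0 <= x u) ->
    (forall u, P u -> #|[pred v | P v && r v u]|%:R <= K) ->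
  \sum_(u | P u) \sum_(v | P v && r v u) x u * x v <=
  K * \sum_(u | P u) x u ^+ 2.
Proof.
move=> r_sym x_ge0 cardK.
have half : \sum_(u | P u) \sum_(v | P v && r v u) x u ^+ 2 <=
            K * \sum_(u | P u) x u ^+ 2.
  rewrite mulr_sumr; apply: ler_sum => u Pu.
  by rewrite sumr_const -mulr_natl ler_wpM2r ?exprn_ge0 ?cardK.
have halfE : \sum_(u | P u) \sum_(v | P v && r v u) x v ^+ 2 =
             \sum_(u | P u) \sum_(v | P v && r v u) x u ^+ 2.
  rewrite (exchange_big_dep P) => [|u v _ /andP[]//] /=.
  apply: eq_bigr => v Pv; apply: eq_bigl => u.
  by rewrite Pv r_sym.
apply: le_trans half; rewrite -(ler_pM2l (ltr0n _ 2)).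
rewrite [leRHS]mulr_natl [leRHS]mulr2n -[X in X + _]halfE.
rewrite -big_split mulr_sumr /=.
apply: ler_sum => u _; rewrite -big_split mulr_sumr /=; apply: ler_sum => v _.
rewrite -subr_ge0.
have -> : x v ^+ 2 + x u ^+ 2 - 2 * (x u * x v) = (x u - x v) ^+ 2 by ring.
by rewrite real_exprn_even_ge0 // rpredB ?ger0_real.
Qed.

Variables (n d : nat) (zeta : C).
Hypothesis zeta_prim : (d.+1).*2.-primitive_root zeta.

Lemma bmultinom_lt (u : bmultinom n d.+1) i : (bmnm u i < d.+1)%N.
Proof.
rewrite (leq_ltn_trans _ (bmdeg u)) // mdegE.
by rewrite (bigD1 i) //= leq_addr.
Qed.

(** Parseval for the polynomial and for its square gives the second and fourth moments that
    [sqr_norm_le_norm1] needs. The order [2 (d + 1)] of [zeta] exceeds every exponent of the square,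
    these being at most [2 d]. *)
Lemma homogeneous_norm2_le_norm1 (b : bmultinom n d.+1 -> C) (m : nat) :
  ((d.+1).*2 ^ n)%:R * sqrtC (\sum_(u | mdeg (bmnm u) == m) `|b u| ^+ 2) <=
  2 ^+ m * \sum_(k : {ffun 'I_n -> 'I_((d.+1).*2)})
    `|\sum_(u | mdeg (bmnm u) == m)
                       b u * mmap1 (torus_pt zeta k) (bmnm u)|.
Proof.
set P := fun u : bmultinom n d.+1 => mdeg (bmnm u) == m.
set S := \sum_(u | P u) _.
apply: sqr_norm_le_norm1 => [|||| ].
- by rewrite exprn_gt0 ?ltr0n.
- by rewrite sqrtC_ge0 sumr_ge0 // => u _; rewrite exprn_ge0.
- by [].
- rewrite (torus_sqr_norm zeta_prim) => [|u i].
    rewrite sqrtCK; congr (_ * _); apply: eq_bigr => u Pu.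
    rewrite (big_pred1 u) => [|v]; first by rewrite normCK.
    by rewrite (inj_eq val_inj) /=; case: (v =P u) => [->|]; rewrite ?Pu ?andbF.
  by rewrite (leq_trans (bmultinom_lt u i)) // -addnn leq_addr.
rewrite sqrtCK.
pose P2 := fun u : bmultinom n d.+1 * bmultinom n d.+1 => P u.1 && P u.2.
pose b2 := fun u : bmultinom n d.+1 * bmultinom n d.+1 => b u.1 * b u.2.
pose e2 := fun u : bmultinom n d.+1 * bmultinom n d.+1 =>
  mnm_add (bmnm u.1) (bmnm u.2).
have sqrE (k : {ffun 'I_n -> 'I_((d.+1).*2)}) :
    `|\sum_(u | P u) b u * mmap1 (torus_pt zeta k) (bmnm u)| ^+ 4 =
    `|\sum_(u | P2 u) b2 u * mmap1 (torus_pt zeta k) (e2 u)| ^+ 2.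
  rewrite (exprM _ 2 2) -[in LHS]normrX; congr (`|_| ^+ 2).
  rewrite expr2 big_distrlr pair_big /=; apply: eq_bigr => u _.
  rewrite mulrACA; congr (_ * _).
  by rewrite /mmap1 -big_split; apply: eq_bigr => i _; rewrite mnmDE exprD.
under eq_bigr do rewrite sqrE.
have T_ge0 : 0 <= ((d.+1).*2 ^ n)%:R :> C by rewrite ler0n.
(* The fourth moment, being nonnegative, equals its own norm; this opens the complex double sum from
   Parseval to the triangle inequality. *)
rewrite -[leLHS]ger0_norm; last by apply: sumr_ge0 => k _; rewrite exprn_ge0.
rewrite (torus_sqr_norm zeta_prim) => [|u i]; last first.
  by rewrite mnmDE -addnn -addSn leq_add ?bmultinom_lt // ltnW ?bmultinom_lt.
rewrite normrM (ger0_norm T_ge0) ler_wpM2l //.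
apply: le_trans (ler_norm_sum _ _ _) _.
apply: le_trans (_ : \sum_(u | P2 u) \sum_(v | P2 v && (e2 v == e2 u))
  `|b2 u| * `|b2 v| <= _).
  apply: ler_sum => u _; apply: le_trans (ler_norm_sum _ _ _) _.
  by apply: ler_sum => v _; rewrite normrM norm_conjC.
pose r2 : rel _ := fun u v => e2 u == e2 v.
apply: le_trans (schur_test (K := 4 ^+ m) (r := r2) _ _ _) _ => //.
- by move=> u v; rewrite /r2 eq_sym.
- move=> u /andP[/eqP P1 /eqP Q1]; have -> : 4 ^+ m = 2 ^+ mdeg (e2 u) :> C.
    by rewrite mdegD P1 Q1 addnn -mul2n exprM; congr (_ ^+ _); ring.
  by apply: card_splittings => v /andP[_ /eqP].
rewrite exprMn -exprM mulnC exprM (_ : 2 ^+ 2 = 4); last by ring.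
rewrite ler_wpM2l ?exprn_ge0 ?ler0n // expr2 /S big_distrlr pair_big /=.
by apply: ler_sum => u _; rewrite normrM exprMn.
Qed.

End Hypercontractivity.

(** * Coefficient sums of a homogeneous part *)

Section CoefficientBound.
Variable C : numClosedFieldType.

Lemma coef01_prod (I : Type) (r : seq I) (f : I -> {poly C}) :
    (forall i, (f i)`_0 = 1) ->
  (\prod_(i <- r) f i)`_0 = 1 /\
  (\prod_(i <- r) f i)`_1 = \sum_(i <- r) (f i)`_1.
Proof.
move=> f0; elim: r => [|i r [IH0 IH1]]; first by rewrite !big_nil !coef1.
rewrite !big_cons coef0M coefM !big_ord_recl big_ord0 /= f0 IH0 IH1.
by rewrite !mul1r mulr1 addr0 addrC.
Qed.

Lemma coef1_exp (f : {poly C}) (k : nat) : f`_0 = 1 ->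
  (f ^+ k)`_0 = 1 /\ (f ^+ k)`_1 = k%:R * f`_1.
Proof.
move=> f0; have := @coef01_prod _ (index_enum 'I_k) (fun=> f) (fun=> f0).
by rewrite prodr_const sumr_const card_ord mulr_natl.
Qed.

Variables (n d : nat) (a : bmultinom n d.+1 -> C).

Definition homog_eval (m : nat) (z : 'I_n -> C) : C :=
  \sum_(u : bmultinom n d.+1 | mdeg (bmnm u) == m) a u * mmap1 z (bmnm u).

Lemma mmap1_scale (t : C) (z : 'I_n -> C) (m : multinom n) :
  mmap1 (fun i => t * z i) m = t ^+ mdeg m * mmap1 z m.
Proof.
rewrite /mmap1 mdegE -prodrXr -big_split /=.
by apply: eq_bigr => i _; rewrite exprMn.
Qed.

(** Along the slice [t |-> p (t z)] the homogeneous parts at [z] become the coefficients of [t], so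
    the one-variable bound applies. *)
Lemma homog_eval_le (M : C) (m : nat) (z : 'I_n -> C) :
    (forall w : 'I_n -> C, (forall i, `|w i| < 1) ->
       `|\sum_u a u * mmap1 w (bmnm u)| <= M) ->
    (0 < m)%N -> (forall i, `|z i| < 1) ->
  `|homog_eval m z| <= 2 * (M - `|homog_eval 0 z|).
Proof.
move=> aM m_gt0 z_lt1.
pose f : {poly C} := \sum_u (a u * mmap1 z (bmnm u)) *: 'X^(mdeg (bmnm u)).
have fE l : f`_l = homog_eval l z.
  rewrite coef_sum /homog_eval [RHS]big_mkcond; apply: eq_bigr => u _.
  by rewrite coefZ coefXn eq_sym; case: eqP; rewrite ?mulr1 ?mulr0.
rewrite -!fE; apply: coef_le_sup_sub0 => // t t1.
have -> : f.[t] = \sum_u a u * mmap1 (fun i => t * z i) (bmnm u).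
  rewrite horner_sum; apply: eq_bigr => u _.
  by rewrite hornerZ hornerXn mmap1_scale; ring.
by apply: aM => i; rewrite normrM t1 mul1r.
Qed.

(* The coefficient of [s] in [3^m * homog_eval m (w_i (1 + eps_i s) / 3)] is
   [\sum_i eps_i D_i], where [D_i] is the i-th summand of the left-hand side
   without the modulus; the phases [eps_i] are chosen to make [eps_i D_i]
   nonnegative. The points involved lie in the disc of radius 2/3. *)
Lemma sum_euler_le (B : C) (m : nat) (w : 'I_n -> C) :
    (forall z, (forall i, `|z i| < 1) -> `|homog_eval m z| <= B) ->
    (forall i, `|w i| = 1) ->
  \sum_i `|\sum_(u : bmultinom n d.+1 | mdeg (bmnm u) == m)
             (bmnm u i)%:R * a u * mmap1 w (bmnm u)| <= 3 ^+ m * B.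
Proof.
move=> aB w1.
pose D i := \sum_(u : bmultinom n d.+1 | mdeg (bmnm u) == m)
  (bmnm u i)%:R * a u * mmap1 w (bmnm u).
rewrite -[leLHS]/(\sum_i `|D i|).
have [eps eps1 epsD] := fin_all_exists2 (fun i => exists_phase (D i)).
pose lin i : {poly C} := 1 + eps i *: 'X.
have lin0 i : (lin i)`_0 = 1 by rewrite coefD coef1 coefZ coefX mulr0 addr0.
have lin1 i : (lin i)`_1 = eps i by rewrite coefD coef1 coefZ coefX mulr1 add0r.
pose f : {poly C} := \sum_(u | mdeg (bmnm u) == m)
  (a u * mmap1 w (bmnm u)) *: \prod_i lin i ^+ bmnm u i.
have -> : \sum_i `|D i| = `|f`_1|.
  have -> : f`_1 = \sum_i `|D i|; last first.
    by rewrite ger0_norm // sumr_ge0.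
  rewrite coef_sum (eq_bigr _ (fun i _ => esym (epsD i))).
  rewrite (eq_bigr _ (fun i _ => mulr_sumr _ _ _ _)) exchange_big /=.
  apply: eq_bigr => u _; rewrite coefZ.
  have [|_ ->] := @coef01_prod _ (index_enum 'I_n) (fun i => lin i ^+ bmnm u i).
    by move=> i; have [] := coef1_exp (bmnm u i) (lin0 i).
  rewrite mulr_sumr; apply: eq_bigr => i _.
  by have [_ ->] := coef1_exp (bmnm u i) (lin0 i); rewrite lin1; ring.
apply: coef_le_sup => t t1.
pose v i := (3^-1 : C) * (w i * (1 + eps i * t)).
have -> : f.[t] = 3 ^+ m * homog_eval m v.
  rewrite horner_sum mulr_sumr; apply: eq_bigr => u /eqP degu.
  rewrite hornerZ mmap1_scale degu horner_prod exprVn.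
  rewrite mulrCA mulVKf ?expf_neq0 ?pnatr_eq0 // -mulrA; congr (_ * _).
  rewrite /mmap1 -big_split /=; apply: eq_bigr => i _.
  by rewrite horner_exp hornerD hornerZ hornerX hornerC exprMn.
rewrite normrM normrX normr_nat ler_wpM2l ?exprn_ge0 ?ler0n //.
apply: aB => i; rewrite normrM normfV normr_nat ltr_pdivrMl ?ltr0n // mulr1.
rewrite normrM w1 mul1r (le_lt_trans (ler_normD _ _)) //.
by rewrite normr1 normrM eps1 t1 mulr1 -(natrD _ 1 1) ltr_nat.
Qed.

Lemma sum_coef_le (M x : C) (k : nat) :
    (forall w : 'I_n -> C, (forall i, `|w i| < 1) ->
       `|\sum_u a u * mmap1 w (bmnm u)| <= M) ->
    0 < x < 1 ->
  \sum_(u : bmultinom n d.+1 | mdeg (bmnm u) == k.+1) `|a u| <=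
  2 * 6 ^+ k.+1 * sqrtC (x ^- k * (1 - x) ^- n) *
    (M - `|homog_eval 0 (fun=> 0)|).
Proof.
move=> aM x01; set K := x ^- k * _; set A0 := homog_eval 0 _; set m := k.+1.
have A0E z : homog_eval 0 z = A0.
  apply: eq_bigr => u /eqP degu; rewrite /mmap1 !big1 // => i _;
  move/eqP: degu; rewrite mdeg_eq0 => /eqP ->; by rewrite mnm0E expr0.
have hB z : (forall i, `|z i| < 1) -> `|homog_eval m z| <= 2 * (M - `|A0|).
  by move=> z1; rewrite -(A0E z); apply: homog_eval_le.
set B := 2 * (M - `|A0|) in hB *.
have [zeta zP] := @closed_prim_root_exists C (d.+1).*2 isT.
pose P := fun u : bmultinom n d.+1 => mdeg (bmnm u) == m.
(* [b i] lists the coefficients of [w_i d_i P_m]. *)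
pose b (i : 'I_n) (u : bmultinom n d.+1) := (bmnm u i)%:R * a u.
pose S i := \sum_(u | P u) `|b i u| ^+ 2.
have T_gt0 : 0 < (((d.+1).*2 ^ n)%:R : C) by rewrite ltr0n expn_gt0.
have S_ge0 i : 0 <= S i by rewrite sumr_ge0 // => u _; rewrite exprn_ge0.
have K_ge0 : 0 <= K.
  have /andP[x_gt0 x_lt1] := x01.
  by rewrite mulr_ge0 // invr_ge0 exprn_ge0 ?subr_ge0 ?ltW.
(* The norm comparison is applied for each [i]; exchanging the sums then lets [sum_euler_le] bound
   the sum over [i] at each torus point. The constant is [6 = 2 * 3]. *)
have sumS : \sum_i sqrtC (S i) <= 6 ^+ m * B.
  rewrite -(ler_pM2l T_gt0) mulr_sumr.
  apply: le_trans (_ : \sum_i 2 ^+ m * \sum_(k : {ffun 'I_n -> 'I_((d.+1).*2)})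
    `|\sum_(u | P u) b i u * mmap1 (torus_pt zeta k) (bmnm u)| <= _).
    by apply: ler_sum => i _; apply: homogeneous_norm2_le_norm1.
  rewrite -mulr_sumr exchange_big /=.
  have -> : ((d.+1).*2 ^ n)%:R * (6 ^+ m * B) =
            2 ^+ m * \sum_(k : {ffun 'I_n -> 'I_((d.+1).*2)}) (3 ^+ m * B) :> C.
    rewrite sumr_const card_ffun !card_ord -mulr_natl.
    have -> : 6 = 2 * 3 :> C by rewrite -natrM.
    by rewrite exprMn; ring.
  rewrite ler_wpM2l ?exprn_ge0 ?ler0n //; apply: ler_sum => l _.
  by apply: sum_euler_le => // i; apply: norm_torus_pt zP _ _.
apply: le_trans (_ : \sum_i sqrtC K * sqrtC (S i) <= _); last first.
  rewrite -mulr_sumr mulrC.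
  apply: le_trans (ler_wpM2r _ sumS) _; first by rewrite sqrtC_ge0.
  by rewrite /B le_eqVlt; apply/orP/or_introl/eqP; ring.
(* A multi-index of positive degree contains some variable [i], and then [|a u| <= |b i u|]. *)
apply: le_trans (_ : \sum_i \sum_(u | P u && (0 < bmnm u i)%N) `|b i u| <= _).
  rewrite (eq_bigr _ (fun i _ => big_mkcondr _ _ _ _ _)) exchange_big /=.
  apply: ler_sum => u /eqP degu.
  have /existsP[i ui] : [exists i, 0 < bmnm u i]%N.
    apply: contraT; rewrite negb_exists => /forallP u0; move/eqP: degu.
    by rewrite mdegE big1 // => i _; move: (u0 i); rewrite lt0n negbK => /eqP.
  rewrite (bigD1 i) //= ui -[leLHS]addr0 lerD //.
    by rewrite normrM normr_nat ler_peMl // ler1n.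
  by apply: sumr_ge0 => j _; case: ifP.
apply: ler_sum => i _.
(* Cauchy-Schwarz over the multi-indices that contain [i], at most [K] in number. *)
rewrite -(@ler_pXn2r _ 2) ?nnegrE ?sumr_ge0 ?mulr_ge0 ?sqrtC_ge0 //.
rewrite exprMn !sqrtCK; apply: le_trans (sqr_sum_le _ _) _ => //.
have sq_ge0 u : 0 <= `|b i u| ^+ 2 by rewrite exprn_ge0.
apply: ler_pM; rewrite ?ler0n ?sumr_ge0 //.
  exact: card_mdeg_le.
rewrite /S [leRHS](bigID (fun u => 0 < bmnm u i)%N) /= lerDl.
by rewrite sumr_ge0.
Qed.
End CoefficientBound.

(** * Summation over all degrees *)

Section BohrSum.
Variables (C : numClosedFieldType) (n d : nat) (a : bmultinom n d.+1 -> C).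

Lemma bohr_sum_le (M x r : C) :
    (forall w : 'I_n -> C, (forall i, `|w i| < 1) ->
       `|\sum_u a u * mmap1 w (bmnm u)| <= M) ->
    0 < x < 1 -> x <= (1 - x) ^+ n -> 0 <= r -> r ^+ 2 = x / 576 ->
  \sum_u `|a u| * r ^+ mdeg (bmnm u) <= M.
Proof.
move=> aM x01 xn r_ge0 rE; have /andP[x_gt0 x_lt1] := x01.
have deg0E (u : bmultinom n d.+1) : (mdeg (bmnm u) == 0%N) = pred1 bm0 u.
  by rewrite mdeg_eq0.
set A0 := homog_eval a 0 (fun=> 0).
have A0_le : 0 <= M - `|A0|.
  (* The bound in degree 1, taken at the origin, forces its right-hand side to be nonnegative. *)
  have := @homog_eval_le _ _ _ a M 1 (fun=> 0) aM isT.
  rewrite normr0 ltr01 => /(_ (fun=> isT)) /(le_trans (normr_ge0 _)).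
  by rewrite pmulr_rge0 ?ltr0n.
have term k : \sum_(u : bmultinom n d.+1 | mdeg (bmnm u) == k.+1)
      `|a u| * r ^+ mdeg (bmnm u) <= 2 * 4 ^- k.+1 * (M - `|A0|).
  rewrite (eq_bigr (fun u => `|a u| * r ^+ k.+1)) => [|u /eqP -> //].
  rewrite -mulr_suml.
  apply: le_trans (ler_wpM2r (exprn_ge0 _ r_ge0) (sum_coef_le k aM x01)) _.
  rewrite mulrAC ler_wpM2r // -!mulrA ler_wpM2l ?ler0n //.
  (* Compare squares: since [x <= (1 - x) ^+ n], the left one is at most
     [(36 / 576)^(k + 1) = 16^-(k + 1)]. *)
  rewrite -(@ler_pXn2r _ 2) ?nnegrE ?mulr_ge0 ?invr_ge0 ?exprn_ge0 ?ler0n //;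
    last first.
  - by rewrite sqrtC_ge0 mulr_ge0 // invr_ge0 exprn_ge0 ?subr_ge0 ?ltW.
  rewrite !exprMn sqrtCK -exprVn -!exprM !(mulnC k.+1) !exprM rE.
  have -> : x ^- k * (1 - x) ^- n * (x / 576) ^+ k.+1 =
      x / (1 - x) ^+ n * 576 ^- k.+1.
    rewrite exprMn exprVn exprS; field.
    by rewrite !expf_neq0 ?gt_eqF ?ltr0n ?subr_gt0.
  rewrite mulrCA; apply: (@le_trans _ _ (1 * ((6 ^+ 2) ^+ k.+1 * 576 ^- k.+1))).
    by rewrite ler_wpM2r ?mulr_ge0 ?invr_ge0 ?exprn_ge0 ?ler0n //
      ler_pdivrMr ?mul1r // exprn_gt0 // subr_gt0.
  rewrite mul1r -exprVn -exprMn le_eqVlt; apply/orP/or_introl/eqP.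
  by congr (_ ^+ _); field.
rewrite (partition_big (fun u => Ordinal (bmdeg u)) xpredT) //=.
rewrite big_ord_recl /=.
have -> : \sum_(u : bmultinom n d.+1 | Ordinal (bmdeg u) == ord0)
    `|a u| * r ^+ mdeg (bmnm u) = `|A0|.
  rewrite (big_pred1 bm0) => [|u]; last by rewrite -deg0E.
  rewrite /A0 /homog_eval (big_pred1 bm0 deg0E) /= mdeg0 expr0 mulr1.
  by rewrite mmap11 mulr1.
rewrite -lerBrDl.
apply: le_trans (_ : \sum_(k < d) 2 * 4 ^- k.+1 * (M - `|A0|) <= _).
  by apply: ler_sum => k _; apply: le_trans (term k); rewrite le_eqVlt eqxx.
(* The factor in front of [M - |A0|] is below [2 \sum_(k >= 1) 4^-k = 2 / 3]. *)
rewrite -mulr_suml -mulr_sumr ler_piMl //.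
have -> : \sum_(k < d) 4 ^- k.+1 = (1 - 4 ^- d) / 3 :> C.
  elim: (d) => [|e IHe]; first by rewrite big_ord0 expr0 invr1 subrr mul0r.
  rewrite big_ord_recr /= IHe exprS; field.
  by rewrite expf_neq0 // pnatr_eq0.
rewrite mulrA ler_pdivrMr ?ltr0n // mul1r.
apply: (@le_trans _ _ (2 * 1)); last by rewrite mulr1 ler_nat.
by rewrite ler_wpM2l ?ler0n // gerBl invr_ge0 exprn_ge0 ?ler0n.
Qed.
End BohrSum.

(** * The Bohr inequality for complex polynomials *)

Section BohrRadius.
Variable R : realType.
Local Open Scope classical_set_scope.
Local Open Scope complex_scope.

Lemma modulusE (z : R[i]) : `|z| = (modulus z)%:C.
Proof. by []. Qed.

Lemma modulus_ge0 (z : R[i]) : 0 <= modulus z.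
Proof. by case: z => u v; apply: sqrtr_ge0. Qed.

Lemma modulusM (z w : R[i]) : modulus (z * w) = modulus z * modulus w.
Proof. exact: ComplexField.Normc.normcM. Qed.

Lemma modulus_real (r : R) : 0 <= r -> modulus r%:C = r.
Proof.
by move=> r_ge0; apply: complexI; rewrite -modulusE ger0_norm // ler0c.
Qed.

Lemma abs_sumE n (p : mpoly n R[i]) (z : 'I_n -> R[i]) :
  abs_sum p z = \sum_(u : bmultinom n (msize p).+1)
    modulus (mcoeff (bmnm u) p) * modulus (mmap1 z (bmnm u)).
Proof.
rewrite /abs_sum (ssrcomplements.big_mksub (bmultinom n (msize p).+1)) /=.
- rewrite big_rmcond /= => [|u /memN_msupp_eq0 ->].
    by apply: eq_bigr => u _; rewrite modulusM.
  by rewrite mul0r ComplexField.Normc.normc0.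
- exact: msupp_uniq.
- by move=> m /msize_mdeg_lt /leqW.
Qed.

Lemma modulus_mmap1_le n (z : 'I_n -> R[i]) (r : R) (m : multinom n) :
  (forall i, modulus (z i) <= r) -> modulus (mmap1 z m) <= r ^+ mdeg m.
Proof.
move=> zr; rewrite -lecR -modulusE normr_prod mdegE -prodrXr rmorph_prod.
apply: ler_prod => i _; rewrite normr_ge0 rmorphXn normrX /=.
rewrite lerXn2r ?nnegrE ?normr_ge0 ?modulusE ?ler0c ?lecR //.
by rewrite (le_trans _ (zr i)) ?modulus_ge0.
Qed.

Lemma bohr_inequality_of n (x r : R) :
  0 < x < 1 -> x <= (1 - x) ^+ n -> 0 <= r -> r ^+ 2 = x / 576 ->
  bohr_inequality n r.
Proof.
move=> /andP[x_gt0 x_lt1] xn r_ge0 rE p.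
set S := ereal_sup [set _ | _ in polydisc R n].
have S_ge0 : (0 <= S)%E.
  apply: (@le_trans _ _ (modulus (meval (fun=> 0) p))%:E).
    by rewrite lee_fin modulus_ge0.
  apply: ereal_sup_ubound; exists (fun=> 0) => // k.
  suff : modulus (0 : R[i]) < 1 by [].
  by rewrite ComplexField.Normc.normc0.
apply: ge_ereal_sup => _ [_ [w w1 <-] <-].
(* An infinite supremum leaves nothing to prove, and [S_ge0] excludes [-oo]. *)
case SE : S S_ge0 => [M| |] // M_ge0; last by rewrite leey.
rewrite lee_fin abs_sumE.
apply: (@le_trans _ _ (\sum_(u : bmultinom n (msize p).+1)
    modulus (mcoeff (bmnm u) p) * r ^+ mdeg (bmnm u))).
  apply: ler_sum => u _; rewrite ler_wpM2l ?modulus_ge0 //.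
  rewrite modulus_mmap1_le // => i.
  by rewrite modulusM modulus_real // ler_piMr // ltW.
rewrite -lecR.
have -> : (\sum_(u : bmultinom n (msize p).+1)
      modulus (mcoeff (bmnm u) p) * r ^+ mdeg (bmnm u))%:C =
    \sum_(u : bmultinom n (msize p).+1)
      `|mcoeff (bmnm u) p| * r%:C ^+ mdeg (bmnm u).
  by rewrite rmorph_sum; apply: eq_bigr => u _; rewrite rmorphM rmorphXn.
apply: (@bohr_sum_le _ _ _ (fun u => mcoeff (bmnm u) p) M%:C x%:C r%:C).
- move=> z z1; rewrite modulusE lecR -lee_fin -SE; apply: ereal_sup_ubound.
  exists z; first by move=> k; rewrite /= -ltcR -modulusE.
  congr ((modulus _)%:E); exact: mmapE.
- by rewrite -[0]/(0%:C) -[1]/(1%:C) !ltcR x_gt0.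
- by rewrite -[1]/(1%:C) -rmorphB -rmorphXn lecR.
- by rewrite ler0c.
- by rewrite -rmorphXn rE rmorphM fmorphV rmorph_nat.
Qed.

(** * Existence of the Bohr radius and choice of the parameter *)

Lemma bohr_inequality_le1 n (r : R) :
  (0 < n)%N -> bohr_inequality n r -> r <= 1.
Proof.
move=> n_gt0 bohr; rewrite leNgt; apply/negP => r_gt1.
have r_gt0 : 0 < r by rewrite (lt_trans ltr01).
(* The test polynomial is a single variable; [s] is the midpoint of [r^-1] and 1, so that
   [s < 1 < r * s]. *)
pose i0 := Ordinal n_gt0; pose p : mpoly n R[i] := mpolyX R[i] (mnm1 i0).
pose s := (1 + r^-1) / 2.
have s_ge0 : 0 <= s by rewrite divr_ge0 // addr_ge0 // invr_ge0 ltW.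
have s_lt1 : s < 1.
  by rewrite ltr_pdivrMr // mul1r ltrD2l invf_lt1.
have rs_gt1 : 1 < r * s.
  by rewrite /s mulrA ltr_pdivlMr // mul1r mulrDr mulr1 divff ?gt_eqF // ltrD2r.
have := bohr p; apply/negP; rewrite -ltNge; apply: (@le_lt_trans _ _ 1%:E).
  apply: ge_ereal_sup => _ [z z1 <-].
  by rewrite lee_fin /p mevalXU ltW.
apply: (@lt_le_trans _ _ (r * s)%:E); first by rewrite lte_fin.
apply: ereal_sup_ubound; exists (fun=> r%:C * s%:C).
  exists (fun=> s%:C) => // k; suff : modulus s%:C < 1 by [].
  by rewrite modulus_real.
rewrite /abs_sum msuppX big_seq1 mcoeffX eqxx mul1r mmap1U.
by rewrite -rmorphM modulus_real // mulr_ge0 // ltW.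
Qed.

(* The left-hand side at [K] is a supremum over an open polydisc, each point of
   which lies in [r * polydisc] for some admissible [r < K]. *)
Lemma bohr_radius_exists n (r0 : R) : (0 < n)%N -> 0 < r0 ->
  bohr_inequality n r0 -> exists K : R, is_bohr_radius n K /\ r0 <= K.
Proof.
move=> n_gt0 r0_gt0 bohr0.
pose E := [set r : R | 0 < r /\ bohr_inequality n r].
have E0 : E r0 by [].
have hE : has_sup E.
  split; first by exists r0.
  by exists 1 => r [_]; apply: bohr_inequality_le1.
have r0K : r0 <= sup E by apply: ub_le_sup => //; case: hE.
have K_gt0 : 0 < sup E by exact: lt_le_trans r0K.
exists (sup E); split => //; split=> //; last first.
  by move=> r r_gt0 bohr; apply: ub_le_sup => //; case: hE.
move=> p; apply: ge_ereal_sup => _ [_ [w w1 <-] <-].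
pose rho := \big[Num.max/0]_k modulus (w k).
have rho_lt1 : rho < 1.
  by rewrite /rho; elim/big_ind: _ => // y z y1 z1; rewrite gt_max y1 z1.
have w_rho k : modulus (w k) <= rho.
  exact: (le_bigmax _ (fun k => modulus (w k))).
have [r [r_gt0 bohr] ltr] : exists2 r, E r & sup E * rho < r.
  have e_gt0 : 0 < sup E * (1 - rho) by rewrite mulr_gt0 // subr_gt0.
  have [r Er lt] := sup_adherent e_gt0 hE.
  exists r => //; apply: le_lt_trans lt.
  by rewrite mulrBr mulr1 opprB addrC subrK.
apply: le_trans (bohr p); apply: ereal_sup_ubound.
exists (fun k => (sup E)%:C * w k) => //.
exists (fun k => (sup E / r)%:C * w k).
  move=> k; suff : modulus ((sup E / r)%:C * w k) < 1 by [].
  rewrite modulusM modulus_real; last by rewrite divr_ge0 ?ltW.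
  rewrite mulrAC ltr_pdivrMr // mul1r; apply: le_lt_trans ltr.
  by rewrite ler_wpM2l // ltW.
apply/funext => k; rewrite mulrA -rmorphM mulrCA divff ?gt_eqF // mulr1 //.
Qed.

(** With [t = n x] one has [n = exp (4 t - 1)]. As [x <= 1 / 4], [1 - x >= exp (- 2 x)], so it
    suffices that [t <= n exp (- 2 t) = exp (2 t - 1)], which follows from [exp (2 t - 1) >= 2 t].
    The summand 1 beside [ln n] keeps [x] positive at [n = 1]. *)
Lemma bohr_parameter n : (0 < n)%N ->
  let x := (1 + ln (n%:R : R)) / (4 * n%:R) in
  0 < x < 1 /\ x <= (1 - x) ^+ n.
Proof.
move=> n_gt0 x; have n1 : 1 <= n%:R :> R by rewrite ler1n.
have n0 : 0 < n%:R :> R by rewrite ltr0n.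
pose t : R := (1 + ln n%:R) / 4.
have t_ge : 1 / 4 <= t by rewrite ler_pM2r ?invr_gt0 // lerDl ln_ge0.
have xE : x = t / n%:R by rewrite /x /t invfM mulrA.
have nE : n%:R = expR (4 * t - 1) :> R.
  by rewrite /t mulrC divfK // addrC addKr lnK.
have x_gt0 : 0 < x by rewrite xE divr_gt0 //; lra.
have x_le : x <= 1 / 4.
  rewrite xE ler_pdivrMr //.
  by have := expR_ge1Dx (4 * t - 1); rewrite -nE; lra.
split; first by apply/andP; split=> //; lra.
have le1 : expR (- (2 * x)) <= 1 - x.
  rewrite expRN -[leLHS]mul1r ler_pdivrMr ?expR_gt0 //.
  have := expR_ge1Dx (2 * x); nra.
apply: le_trans (_ : expR (- (2 * x)) ^+ n <= _); last first.
  by rewrite lerXn2r ?nnegrE ?expR_ge0 //; lra.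
rewrite -expRM_natl -mulNr mulrCA xE (mulrCA n%:R) divff ?gt_eqF // mulr1.
rewrite ler_pdivrMr // nE -expRD.
have := expR_ge1Dx (2 * t - 1).
have -> : - 2 * t + (4 * t - 1) = 2 * t - 1 by ring.
lra.
Qed.
End BohrRadius.

Theorem theorem2 (R : realType) :
  exists gamma : R, 0 < gamma /\
    forall n : nat, (0 < n)%N ->
      exists K : R, is_bohr_radius n K /\
        gamma * Num.sqrt (ln (n%:R : R) / n%:R) <= K.
Proof.
(* [48 = 2 * 24]: the radius is [sqrt x / 24], and [x] has the denominator [4 n]. *)
exists (48^-1); split => [|n n_gt0]; first by rewrite invr_gt0.
have [/andP[x_gt0 x_lt1] xn] := @bohr_parameter R n n_gt0.
set x := (_ / _) in x_gt0 x_lt1 xn.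
have n0 : 0 < n%:R :> R by rewrite ltr0n.
have x576_gt0 : 0 < x / 576 by apply: divr_gt0 x_gt0 _; rewrite ltr0n.
have r_gt0 : 0 < Num.sqrt (x / 576) by rewrite sqrtr_gt0.
have bohr : bohr_inequality n (Num.sqrt (x / 576)).
  apply: (bohr_inequality_of _ xn (ltW r_gt0)); first by rewrite x_gt0.
  exact: sqr_sqrtr (ltW x576_gt0).
have [K [KP le_K]] := bohr_radius_exists n_gt0 r_gt0 bohr.
exists K; split=> //; apply: le_trans le_K.
have c_gt0 : 0 < 48^-1 :> R by rewrite invr_gt0 ltr0n.
have -> : x / 576 = 48^-1 ^+ 2 * ((1 + ln n%:R) / n%:R).
  by rewrite /x; field; rewrite gt_eqF.
rewrite [leRHS]sqrtrM ?sqr_ge0 // sqrtr_sqr (gtr0_norm c_gt0).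
rewrite ler_pM2l // ler_wsqrtr // ler_pM2r ?invr_gt0 //.
by rewrite lerDr.
Qed.
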